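(* Let $p$ be a prime, $n,m$ positive integers, and $F\colon \mathbb F_p^n \to \mathbb F_p^m$ a function. Put $$\Xi(F)=\sqrt{\frac{(|\mathrm{Im}(F)|-1)\left(|\mathrm{Im}(F)|\,\mathcal N_F-p^{2n-m}\left(p^m-|\mathrm{Im}(F)|\right)\right)}{|\mathrm{Im}(F)|^2}}.$$ Then for each $\beta\in\mathbb F_p^m$ with $|F^{-1}(\beta)|>0$, $$\frac{p^n}{|\mathrm{Im}(F)|}-\Xi(F)\le |F^{-1}(\beta)|\le \frac{p^n}{|\mathrm{Im}(F)|}+\Xi(F).$$ Moreover, if some $\beta\in\mathbb F_p^m$ satisfies one of these two inequalities with equality, then $|F^{-1}(\alpha)|=\frac{p^n-|F^{-1}(\beta)|}{|\mathrm{Im}(F)|-1}$ for all $\alpha\in\mathrm{Im}(F)\setminus\{\beta\}$.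
   Context: $\mathrm{Im}(F)$ denotes the image set of $F$ and $F^{-1}(\beta)=\{x\in\mathbb F_p^n: F(x)=\beta\}$. The scalar product on $\mathbb F_p^k$ is $\langle x,y\rangle=\sum_i x_iy_i$, and $\zeta_p=e^{2\pi i/p}$. The Walsh transform of $F$ is $W_F(b,a)=\sum_{x\in\mathbb F_p^n}\zeta_p^{\langle b,F(x)\rangle-\langle a,x\rangle}$ for $a\in\mathbb F_p^n$, $b\in\mathbb F_p^m$. The imbalance of $F$ is $\mathcal N_F=\frac{1}{p^m}\sum_{b\in\mathbb F_p^m\setminus\{0\}}|W_F(b,0)|^2$.
   Formalization: In the ''moreover'' part, β is required to satisfy |F^{-1}(β)|>0; for β outside Im(F) the claim fails, e.g. p=3, n=m=2 with fibre sizes 1,1,3,4, where the lower bound equals 0 but the fibres are unequal. *)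

(* Defs.v *)
From mathcomp Require Import all_boot all_order all_algebra.
From mathcomp Require Import complex reals trigo.

Set Implicit Arguments.
Unset Strict Implicit.
Unset Printing Implicit Defensive.

Import Order.TTheory GRing.Theory Num.Theory.

Local Open Scope ring_scope.
Local Open Scope complex_scope.

Definition dotp (p k : nat) (x y : 'rV['F_p]_k) : 'F_p :=
  \sum_(i < k) x 0 i * y 0 i.

(* e^(2 pi i / p), by Euler's formula. *)
Definition zeta (R : realType) (p : nat) : R[i] :=
  cos (2 * pi / p%:R) +i* sin (2 * pi / p%:R).

(* The exponent of zeta is the representative in {0, ..., p-1} of an element
   of 'F_p. *)
Definition walsh (R : realType) (p n m : nat)
    (F : 'rV['F_p]_n -> 'rV['F_p]_m)
    (b : 'rV['F_p]_m) (a : 'rV['F_p]_n) : R[i] :=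
  \sum_(x : 'rV['F_p]_n)
    zeta R p ^+ nat_of_ord (dotp b (F x) - dotp a x).

(* Normc.normc is the real-valued modulus on R[i]. *)
Definition imbalance (R : realType) (p n m : nat)
    (F : 'rV['F_p]_n -> 'rV['F_p]_m) : R :=
  (p%:R ^+ m)^-1 *
    \sum_(b : 'rV['F_p]_m | b != 0) Normc.normc (walsh R F b 0) ^+ 2.

Definition im (p n m : nat) (F : 'rV['F_p]_n -> 'rV['F_p]_m) :
    {set 'rV['F_p]_m} :=
  [set F x | x : 'rV['F_p]_n].

Definition fiber (p n m : nat) (F : 'rV['F_p]_n -> 'rV['F_p]_m)
    (beta : 'rV['F_p]_m) : {set 'rV['F_p]_n} :=
  [set x | F x == beta].

(* The exponent 2n - m is an integer and may be negative. *)
Definition Xi (R : realType) (p n m : nat)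
    (F : 'rV['F_p]_n -> 'rV['F_p]_m) : R :=
  Num.sqrt
    ((#|im F|%:R - 1) *
       (#|im F|%:R * imbalance R F
        - p%:R ^ ((2 * n)%N%:Z - m%:Z) * (p%:R ^+ m - #|im F|%:R))
     / #|im F|%:R ^+ 2).

(* Main.v *)
(* Write [k = |Im F|] and [N_a = |F^-1(a)|].  Orthogonality of the additive
   characters of [F_p^m] gives Parseval's identity
   [sum_b |W_F(b,0)|^2 = p^m sum_a N_a^2], so the imbalance is
   [sum_a N_a^2 - p^(2n-m)] and [Xi^2 = (k-1)(k sum_a N_a^2 - p^(2n)) / k^2].
   Cauchy-Schwarz over the values [a <> b] of [F], with its defect kept as a sum
   of squares, turns this into
   [Xi^2 = (N_b - p^n/k)^2 + (k-1)/k sum_(a <> b) (N_a - c)^2] where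
   [c = (p^n - N_b)/(k-1)]: this yields the bounds and the equality case. *)
Require Import Defs.
From mathcomp Require Import all_boot all_order all_algebra.
From mathcomp Require Import complex reals trigo.
From mathcomp Require Import ring lra.

Import Order.TTheory GRing.Theory Num.Theory.

Local Open Scope ring_scope.

Lemma zetaX (R : realType) (p k : nat) :
  zeta R p ^+ k =
    (cos (k%:R * (2 * pi / p%:R)) +i* sin (k%:R * (2 * pi / p%:R)))%C.
Proof.
elim: k => [|k IHk]; first by rewrite expr0 mul0r cos0 sin0.
rewrite exprS IHk /zeta; set t := _ / _; rewrite -natr1 mulrDl mul1r cosD sinD.
by apply/eqP; rewrite eq_complex /=; apply/andP; split; apply/eqP; ring.
Qed.

Lemma zeta_expp (R : realType) (p : nat) : (0 < p)%N -> zeta R p ^+ p = 1.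
Proof.
move=> p_gt0; rewrite zetaX mulrC divfK ?pnatr_eq0 -?lt0n //.
by rewrite mulr_natl cos2pi sin2pi.
Qed.

Lemma zeta_neq1 (R : realType) (p : nat) : (1 < p)%N -> zeta R p != 1.
Proof.
move=> p_gt1; rewrite /zeta eq_complex /= negb_and.
have p_gt0 : 0 < p%:R :> R by rewrite ltr0n ltnW.
have t_gt0 : 0 < 2 * pi / p%:R :> R by rewrite divr_gt0 // mulr_gt0 ?pi_gt0.
have t_lepi : 2 * pi / p%:R <= pi :> R.
  by rewrite ler_pdivrMr // mulrC ler_wpM2l ?pi_ge0 // ler_nat.
apply/orP; left; apply/eqP; rewrite -[RHS]cos0 => /cos_inj t_eq0.
by have := t_gt0; rewrite t_eq0 ?ltxx // in_itv /= ?lexx ?pi_ge0 // (ltW t_gt0).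
Qed.

Lemma dotpBr (p k : nat) (b x y : 'rV['F_p]_k) :
  dotp b (x - y) = dotp b x - dotp b y.
Proof. by rewrite -sumrB; apply: eq_bigr => i _; rewrite !mxE mulrBr. Qed.

Lemma dotpDl (p k : nat) (b c x : 'rV['F_p]_k) :
  dotp (b + c) x = dotp b x + dotp c x.
Proof. by rewrite -big_split; apply: eq_bigr => i _; rewrite !mxE mulrDl. Qed.

Lemma dotp0l (p k : nat) (x : 'rV['F_p]_k) : dotp 0 x = 0.
Proof. by apply: big1 => i _; rewrite !mxE mul0r. Qed.

Lemma dotp_surj (p k : nat) (x : 'rV['F_p]_k) (c : 'F_p) :
  x != 0 -> exists b, dotp b x = c.
Proof.
move=> /rV0Pn[i xi_neq0]; exists (\row_j (c / x 0 i *+ (j == i))).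
rewrite /dotp (bigD1 i) //= big1 => [|j /negPf jNi].
  by rewrite mxE eqxx mulr1n divfK // addr0.
by rewrite mxE jNi mulr0n mul0r.
Qed.

Lemma sum_card_fiber (p n m : nat) (F : 'rV['F_p]_n -> 'rV['F_p]_m) :
  prime p -> (\sum_(beta in im F) #|fiber F beta| = p ^ n)%N.
Proof.
move=> p_prime; have <- : #|{: 'rV['F_p]_n}| = (p ^ n)%N by rewrite card_mx mul1n card_Fp.
rewrite -sum1_card (partition_big F (mem (im F))) /= => [|x _]; last exact: imset_f.
by apply: eq_bigr => beta _; rewrite -sum1_card; apply: eq_bigl => x; rewrite inE.
Qed.

Section Character.

Variables (C : numClosedFieldType) (p : nat) (z : C).
Hypotheses (p_prime : prime p) (z_expp : z ^+ p = 1) (z_neq1 : z != 1).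

Local Notation chi a := (z ^+ nat_of_ord (a : 'F_p)).

Lemma charD (a b : 'F_p) : chi (a + b) = chi a * chi b.
Proof. by rewrite /= expr_mod ?exprD // Fp_cast. Qed.

Lemma charB (a b : 'F_p) : chi (a - b) = chi a * (chi b)^*.
Proof.
have z_norm1 : `|z| = 1.
  apply/eqP; rewrite -(@pexpr_eq1 _ _ p) ?prime_gt0 //.
  by rewrite -normrX z_expp normr1.
rewrite -[in RHS](subrK b a) (charD (a - b)) -mulrA -normCK normrX z_norm1.
by rewrite expr1n expr1n mulr1.
Qed.

Lemma sum_char (m : nat) (v : 'rV['F_p]_m) :
  \sum_(b : 'rV['F_p]_m) chi (dotp b v) = (p ^ m)%:R *+ (v == 0).
Proof.
have [->|v_neq0] := eqVneq v 0.
  rewrite (eq_bigr (fun=> 1)) => [|b _]; last first.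
    by rewrite /dotp big1 ?expr0 // => i _; rewrite mxE mulr0.
  by rewrite sumr_const card_mx mul1n card_Fp.
have [b0 b0E] := @dotp_surj p m v 1 v_neq0.
rewrite mulr0n; apply/eqP; set S := \sum_b _.
suff : (z - 1) * S == 0 by rewrite mulf_eq0 subr_eq0 (negPf z_neq1).
rewrite mulrBl mul1r subr_eq0; apply/eqP.
rewrite [RHS](reindex_inj (addrI b0)) mulr_sumr; apply: eq_bigr => b _.
by rewrite dotpDl charD b0E /= modn_small // expr1.
Qed.

Lemma sum_sqr_norm_char (n m : nat) (F : 'rV['F_p]_n -> 'rV['F_p]_m) :
  \sum_(b : 'rV['F_p]_m) `|\sum_x chi (dotp b (F x))| ^+ 2
    = (p ^ m)%:R * (\sum_(beta in im F) #|fiber F beta| ^ 2)%:R :> C.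
Proof.
transitivity (\sum_x \sum_y \sum_(b : 'rV['F_p]_m) chi (dotp b (F x - F y))).
  under [RHS]eq_bigr do rewrite exchange_big.
  rewrite exchange_big.
  apply: eq_bigr => b _; rewrite normCK rmorph_sum mulr_suml.
  apply: eq_bigr => x _; rewrite mulr_sumr.
  by apply: eq_bigr => y _; rewrite dotpBr charB.
transitivity (\sum_x (p ^ m)%:R * #|fiber F (F x)|%:R : C).
  apply: eq_bigr => x _; rewrite -sum1_card natr_sum mulr_sumr big_mkcond /=.
  rewrite [RHS]big_mkcond /=.
  apply: eq_bigr => y _; rewrite sum_char subr_eq0 inE eq_sym.
  by case: ifP; rewrite ?mulr1 ?mulr1n.
rewrite -mulr_sumr -natr_sum (partition_big F (mem (im F))) /=; last first.
  by move=> x _; apply: imset_f.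
congr (_ * _%:R); apply: eq_bigr => beta _.
rewrite (eq_bigr (fun=> #|fiber F beta|)) => [|x /eqP->//].
by rewrite sum_nat_cond_const; congr (_ * _)%N; apply: eq_card => x; rewrite !inE.
Qed.

End Character.

Section Imbalance.

Variables (R : realType) (p n m : nat) (F : 'rV['F_p]_n -> 'rV['F_p]_m).
Hypothesis p_prime : prime p.

Lemma walsh_x0 (b : 'rV['F_p]_m) :
  walsh R F b 0 = \sum_x zeta R p ^+ nat_of_ord (dotp b (F x)).
Proof. by apply: eq_bigr => x _; rewrite dotp0l subr0. Qed.

Lemma walsh_00 : walsh R F 0 0 = (p ^ n)%:R.
Proof.
rewrite walsh_x0 (eq_bigr (fun=> 1)) => [|x _]; last by rewrite dotp0l expr0.
by rewrite sumr_const card_mx mul1n card_Fp.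
Qed.

Lemma sum_sqr_walsh :
  \sum_(b : 'rV['F_p]_m) Normc.normc (walsh R F b 0) ^+ 2
    = (p ^ m)%:R * (\sum_(beta in im F) #|fiber F beta| ^ 2)%:R.
Proof.
apply: (@complexI R); rewrite rmorphM !rmorph_nat rmorph_sum.
have := @sum_sqr_norm_char _ p _ p_prime
  (zeta_expp R p (prime_gt0 p_prime)) (zeta_neq1 R p (prime_gt1 p_prime)) n m F.
move=> <-; apply: eq_bigr => b _.
by rewrite -walsh_x0 rmorphXn.
Qed.

Lemma imbalanceE :
  imbalance R F = (\sum_(beta in im F) #|fiber F beta| ^ 2)%:R
                    - p%:R ^ ((2 * n)%N%:Z - m%:Z).
Proof.
have p_neq0 : p%:R != 0 :> R by rewrite pnatr_eq0 -lt0n prime_gt0.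
have pm_neq0 : p%:R ^+ m != 0 :> R by rewrite expf_neq0.
have := sum_sqr_walsh; rewrite (bigD1 0) //= => /(canRL (addKr _)) sumE.
rewrite /imbalance sumE.
have -> : Normc.normc (walsh R F 0 0) = p%:R ^+ n.
  apply: (@complexI R); rewrite -[LHS]/(`|walsh R F 0 0|) walsh_00 normr_nat.
  by rewrite -natrX rmorph_nat.
rewrite expfzDr // -exprnN -exprnP -exprM natrX mulnC.
by field.
Qed.

End Imbalance.

(* The defect in the Cauchy-Schwarz inequality over [A :\ b], written as a sum
   of squares so that the equality case can be read off. When [A] is [[set b]]
   the junk quotient by [0] only occurs under an empty sum. *)
Lemma sum_sqr_dev (R : numFieldType) (T : finType) (A : {set T}) (f : T -> R)
    (b : T) (N := \sum_(a in A) f a) :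
  b \in A ->
  (#|A|%:R - 1) * (#|A|%:R * \sum_(a in A) f a ^+ 2 - N ^+ 2)
    = (#|A|%:R * f b - N) ^+ 2
      + #|A|%:R * (#|A|%:R - 1)
        * \sum_(a in A :\ b) (f a - (N - f b) / (#|A|%:R - 1)) ^+ 2.
Proof.
move=> bA; set c := _ / _; set D := \sum_(a in A :\ b) _.
have sumD1 g : \sum_(a in A) g a = g b + \sum_(a in A :\ b) g a :> R.
  by rewrite (bigD1 b) //=; congr (_ + _); apply: eq_bigl => a; rewrite !inE andbC.
have cardA : #|A|%:R = 1 + #|A :\ b|%:R :> R by rewrite (cardsD1 b) bA natrD.
have NE : N = f b + #|A :\ b|%:R * c.
  have [Ab0|Ab_neq0] := eqVneq (#|A :\ b|%:R : R) 0.
    rewrite Ab0 mul0r /N sumD1; move/eqP: Ab0; rewrite pnatr_eq0 cards_eq0.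
    by move=> /eqP->; rewrite big_set0.
  by rewrite /c cardA [1 + _]addrC addrK mulrC divfK // addrC subrK.
have DE : D = \sum_(a in A :\ b) f a ^+ 2 - #|A :\ b|%:R * c ^+ 2.
  have -> : D = \sum_(a in A :\ b) f a ^+ 2
      - (c *+ 2) * \sum_(a in A :\ b) f a + \sum_(a in A :\ b) c ^+ 2.
    rewrite mulr_sumr -sumrB -big_split; apply: eq_bigr => a _ /=; ring.
  have -> : \sum_(a in A :\ b) f a = #|A :\ b|%:R * c.
    by apply: (addrI (f b)); rewrite -NE -sumD1.
  by rewrite sumr_const -[c ^+ 2 *+ _]mulr_natl; ring.
rewrite DE sumD1 cardA NE; ring.
Qed.

Theorem theorem3p3 (R : realType) (p n m : nat)
    (p_prime : prime p) (n_gt0 : (0 < n)%N) (m_gt0 : (0 < m)%N)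
    (F : 'rV['F_p]_n -> 'rV['F_p]_m) :
  (forall beta : 'rV['F_p]_m, (0 < #|fiber F beta|)%N ->
     p%:R ^+ n / #|im F|%:R - Xi R F <= #|fiber F beta|%:R :> R /\
     #|fiber F beta|%:R <= p%:R ^+ n / #|im F|%:R + Xi R F :> R)
  /\
  (forall beta : 'rV['F_p]_m, (0 < #|fiber F beta|)%N ->
     (p%:R ^+ n / #|im F|%:R - Xi R F = #|fiber F beta|%:R :> R \/
      #|fiber F beta|%:R = p%:R ^+ n / #|im F|%:R + Xi R F :> R) ->
     forall alpha : 'rV['F_p]_m, alpha \in im F :\ beta ->
       #|fiber F alpha|%:R
         = (p%:R ^+ n - #|fiber F beta|%:R) / (#|im F|%:R - 1) :> R).
Proof.
pose k : R := #|im F|%:R; pose f a : R := #|fiber F a|%:R.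
pose N : R := p%:R ^+ n.
pose dev b := \sum_(a in im F :\ b) (f a - (N - f b) / (k - 1)) ^+ 2.
have im_fiber b : (0 < #|fiber F b|)%N -> b \in im F.
  by move=> /card_gt0P[x]; rewrite inE => /eqP <-; apply: imset_f.
have k_ge1 b : b \in im F -> 1 <= k.
  by move=> bF; rewrite ler1n; apply/card_gt0P; exists b.
have dev_ge0 b : 0 <= dev b by apply: sumr_ge0 => a _; apply: sqr_ge0.
have XiE b : b \in im F -> Xi R F ^+ 2 = (f b - N / k) ^+ 2 + (k - 1) / k * dev b.
  move=> bF; have k1 := k_ge1 b bF.
  have k_gt0 : 0 < k by apply: lt_le_trans k1.
  suff E : (k - 1) * (k * imbalance R F
        - p%:R ^ ((2 * n)%N%:Z - m%:Z) * (p%:R ^+ m - k)) / k ^+ 2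
      = (f b - N / k) ^+ 2 + (k - 1) / k * dev b.
    rewrite /Xi sqr_sqrtr -/k E // addr_ge0 ?sqr_ge0 // mulr_ge0 //.
    by rewrite divr_ge0 ?subr_ge0 // ltW.
  have := @sum_sqr_dev _ _ _ f b bF; rewrite -/k -natr_sum.
  rewrite sum_card_fiber // natrX -/N -/(dev b) => devE.
  have p_neq0 : p%:R != 0 :> R by rewrite pnatr_eq0 -lt0n prime_gt0.
  rewrite imbalanceE // natr_sum (eq_bigr (fun a => f a ^+ 2)) => [|a _]; last first.
    by rewrite natrX.
  set S := \sum_(a in _) _ in devE *; set P := p%:R ^ _.
  have PE : P * p%:R ^+ m = N ^+ 2.
    by rewrite -[_ ^+ m]/(_ ^ m%:Z) -expfzDr // subrK -exprM mulnC.
  have -> : (k - 1) * (k * (S - P) - P * (p%:R ^+ m - k))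
      = (k - 1) * (k * S - P * p%:R ^+ m) by ring.
  by rewrite PE devE; field; rewrite gt_eqF.
have Xi_ge0 : 0 <= Xi R F by apply: sqrtr_ge0.
split=> b /im_fiber bF; have := XiE b bF; have k1 := k_ge1 b bF;
  have devb := dev_ge0 b; rewrite -/(f b) -/k -/N => Xi2.
  have : `|f b - N / k| <= Xi R F.
    rewrite -ler_sqr ?nnegrE // real_normK ?num_real // Xi2 lerDl mulr_ge0 //.
    by rewrite divr_ge0 ?subr_ge0 // (le_trans _ k1).
  by rewrite ler_norml => /andP[? ?]; split; lra.
move=> Xib a aFb.
have /eqP : (k - 1) / k * dev b = 0.
  have : (f b - N / k) ^+ 2 = Xi R F ^+ 2.
    by case: Xib => XibE; [rewrite -XibE | rewrite XibE]; ring.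
  by rewrite Xi2 => /eqP; rewrite -[X in X == _]addr0 (inj_eq (addrI _)) => /eqP.
have k_gt1 : 1 < k.
  by rewrite ltr1n (cardsD1 b) bF ltnS; apply/card_gt0P; exists a.
have k_gt0 : 0 < k by apply: lt_trans k_gt1.
rewrite mulf_eq0 gt_eqF ?divr_gt0 ?subr_gt0 //= => /eqP dev0.
have /eqP := psumr_eq0P (fun a _ => sqr_ge0 _) dev0 aFb.
by rewrite sqrf_eq0 subr_eq0 => /eqP.
Qed.
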